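(* Let $n\ge 1$. The morphism of rings $\psi:\mathbf{M}^*(n)\to \mathbf{H}^*(X_{\Sigma(Q_n)})$ defined on generators by $$\psi(\mathsf{S}_i)=\mathsf{T}_{-i}\quad (i\in[n]),\qquad \psi(\mathsf{S}_\alpha)=\sum_{i\in\alpha}\mathsf{T}_{-i}-\sum_{\beta\in\Phi_{>0},\ \alpha\subseteq\beta}\mathsf{T}_\beta\quad(\alpha\in\Phi_{>1})$$ is an isomorphism.
   Context: Roots. Fix an integer $n\ge1$, $[n]=\{1,\dots,n\}$. For $1\le i\le j\le n$ let $[i,j]=\{i,i+1,\dots,j\}$. $\Phi_{>0}$ is the set of all intervals $[i,j]$ in $[n]$ (positive roots of type $A_n$); $\Phi_{>1}$ is the subset of those with $i<j$ (non-simple roots). $\Phi_{\ge -1}$ is the disjoint union of $\Phi_{>0}$ and the set $-\Pi=\{-1,\dots,-n\}$ of negative simple roots. Fan. Compatibility is the symmetric relation on $\Phi_{\ge -1}$ given by: any two elements of $-\Pi$ are compatible; $-i$ and $\alpha\in\Phi_{>0}$ are compatible iff $i\notin\alpha$; $\alpha,\beta\in\Phi_{>0}$ are not compatible iff either $\alpha\cap\beta=\emptyset$ and $\alpha\cup\beta\in\Phi_{>0}$ (adjacent), or $\alpha\not\subseteq\beta$, $\beta\not\subseteq\alpha$ and $\alpha\cap\beta\ne\emptyset$ (strictly overlapping). Map $\Phi_{\ge-1}$ to the free abelian group on $\alpha_1,\dots,\alpha_n$ by $-i\mapsto-\alpha_i$, $\alpha\mapsto\sum_{i\in\alpha}\alpha_i$.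 The fan $\Sigma(Q_n)$ (smooth and complete; associated with the linearly oriented quiver $Q_n$ of type $A_n$) has as cones those spanned by the images of sets of pairwise compatible elements. $X_{\Sigma(Q_n)}$ is the associated smooth complete complex toric variety and $\mathbf{H}^*(X_{\Sigma(Q_n)})$ its integral cohomology ring. By the standard description of cohomology of smooth complete toric varieties, it is the commutative ring generated by $\mathsf{T}_{-i}$ ($i\in[n]$) and $\mathsf{T}_\alpha$ ($\alpha\in\Phi_{>0}$) (divisor classes of the rays, given degree $1$), with relations $\mathsf{T}_{-i}=\sum_{\alpha\in\Phi_{>0},\,i\in\alpha}\mathsf{T}_\alpha$ for $i\in[n]$; $\mathsf{T}_{-i}\mathsf{T}_\alpha=0$ when $i\in\alpha\in\Phi_{>0}$; and $\mathsf{T}_\alpha\mathsf{T}_\beta=0$ when $\alpha,\beta\in\Phi_{>0}$ are adjacent or strictly overlapping. It is a free abelian group of rank the Catalan number $\frac{1}{n+2}\binom{2n+2}{n+1}$, the number of maximal cones. The ring $\mathbf{M}^*(n)$. It is the commutative ring (over $\mathbb{Z}$) generated by variables $\mathsf{S}_i$ ($i\in[n]$) and $\mathsf{S}_\alpha$ ($\alpha\in\Phi_{>1}$; also written $\mathsf{S}_{i,j}$ if $\alpha=[i,j]$) modulo the relations: (1) $\mathsf{S}_i^2=0$ for $i\in[n]$; (2) $\mathsf{S}_i\mathsf{S}_\alpha=\sum_{j\in\alpha,\,j\ne i}\mathsf{S}_i\mathsf{S}_j$ for $i\in\alpha\in\Phi_{>1}$; (3) for all $\alpha=[a,b]$ and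 $\beta=[c,d]$ in $\Phi_{>1}$ (possibly equal) with $a\le c\le b\le d$ and $\#(\alpha\cap\beta)\ge2$, $$\mathsf{S}_\alpha\mathsf{S}_\beta=\sum_{i<j,\ i,j\in\alpha\cap\beta}\mathsf{S}_i\mathsf{S}_j+\sum_{\ell\in I}\mathsf{S}_{a,\ell}\,\mathsf{S}_{\ell,d}-\sum_{\ell,\,\ell+1\in I}\mathsf{S}_{a,\ell}\,\mathsf{S}_{\ell+1,d},$$ where $I=(\alpha\setminus\{a\})\cap(\beta\setminus\{d\})$. It is graded with all generators in degree $1$. *)

(* Defs.v *)
From HB Require Import structures.
From mathcomp Require Import all_boot all_order all_algebra.
From mathcomp Require Import ring_quotient.
From mathcomp Require Import boolp.
From mathcomp Require Import mpoly.

Set Implicit Arguments.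
Unset Strict Implicit.
Unset Printing Implicit Defensive.

Import GRing.Theory.
Local Open Scope ring_scope.

Notation polyZ I := {mpoly int[#|{: I}|]}.

Definition var {I : finType} (i : I) : polyZ I := 'X_(enum_rank i).

Definition generated {A : comNzRingType} (R : A -> Prop) (p : A) : Prop :=
  exists s : seq (A * A),
    (forall x, x \in s -> R x.2) /\ p = \sum_(x <- s) x.1 * x.2.

Lemma generated_relator (A : comNzRingType) (R : A -> Prop) (p : A) :
  R p -> generated R p.
Proof.
move=> Rp; exists [:: (1, p)]; split; last by rewrite big_seq1 mul1r.
by move=> x; rewrite inE => /eqP ->.
Qed.

Lemma generated0 (A : comNzRingType) (R : A -> Prop) : generated R 0.
Proof. by exists [::]; rewrite big_nil. Qed.

Lemma generatedD (A : comNzRingType) (R : A -> Prop) (p q : A) :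
  generated R p -> generated R q -> generated R (p + q).
Proof.
case=> s [hs ->] [t [ht ->]]; exists (s ++ t); split; last by rewrite big_cat.
by move=> x; rewrite mem_cat => /orP[/hs|/ht].
Qed.

Lemma generatedM (A : comNzRingType) (R : A -> Prop) (a p : A) :
  generated R p -> generated R (a * p).
Proof.
case=> s [hs ->]; exists [seq (a * x.1, x.2) | x <- s]; split.
  by move=> x /mapP[y ys ->] /=; exact: hs ys.
by rewrite big_map mulr_sumr; apply: eq_bigr => x _ /=; rewrite mulrA.
Qed.

Lemma generatedB (A : comNzRingType) (R : A -> Prop) (p q : A) :
  generated R p -> generated R q -> generated R (p - q).
Proof.
by move=> hp hq; apply: generatedD => //; rewrite -mulN1r; apply: generatedM.
Qed.

Lemma generated_sub (A : comNzRingType) (R R' : A -> Prop) :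
  (forall p, R p -> generated R' p) ->
  forall p, generated R p -> generated R' p.
Proof.
move=> hR p [s [hs ->]]; elim: s hs => [|x s IHs] hs.
  by rewrite big_nil; exact: generated0.
rewrite big_cons; apply: generatedD.
  by apply/generatedM/hR/hs; rewrite mem_head.
by apply: IHs => y ys; apply: hs; rewrite inE ys orbT.
Qed.

(* The second field makes the ideal proper, as {ideal_quot _} requires.       *)
Record presentation (I : finType) := Presentation {
  relator :> polyZ I -> Prop;
  relator_const : forall p, relator p -> p.@[fun=> 0] = 0
}.

Definition pideal I (P : presentation I) : {pred polyZ I} :=
  fun p => `[< generated P p >].

Lemma pidealE I (P : presentation I) p : reflect (generated P p) (p \in pideal P).
Proof. exact: asboolP. Qed.

Fact pideal_closed I (P : presentation I) : idealr_closed (pideal P).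
Proof.
split.
- by apply/pidealE/generated0.
- apply/negP => /pidealE [s [hs /(congr1 (fun p => p.@[fun=> 0]))]].
  rewrite meval1 raddf_sum /= big_seq big1 => [|x xs].
    by move/eqP; rewrite oner_eq0.
  by rewrite /= mevalM (relator_const (hs x xs)) mulr0.
- move=> a p q /pidealE hp /pidealE hq; apply/pidealE.
  by apply: generatedD => //; apply: generatedM.
Qed.

HB.instance Definition _ I (P : presentation I) :=
  isIdealr.Build (polyZ I) (pideal P) (pideal_closed P).

Definition presented I (P : presentation I) : comNzRingType :=
  {ideal_quot (pideal P)}.

Definition gen I (P : presentation I) (i : I) : presented P :=
  \pi_({ideal_quot (pideal P)})%qT (var i).

(* The set [n] = {1, ..., n} is represented by 'I_n = {0, ..., n-1}.          *)

Definition posroot (n : nat) := {p : 'I_n * 'I_n | (p.1 <= p.2)%N}.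
HB.instance Definition _ n := Finite.on (posroot n).

Definition lo n (alpha : posroot n) : 'I_n := (val alpha).1.
Definition hi n (alpha : posroot n) : 'I_n := (val alpha).2.

Definition supp n (alpha : posroot n) : {set 'I_n} :=
  [set i : 'I_n | lo alpha <= i <= hi alpha]%N.

Definition nonsimple (n : nat) := {alpha : posroot n | (lo alpha < hi alpha)%N}.
HB.instance Definition _ n := Finite.on (nonsimple n).

(* Phi_{>= -1}: [inl i] is the negative simple root -i.                       *)
Definition root (n : nat) := ('I_n + posroot n)%type.
HB.instance Definition _ n := Finite.on (root n).

Definition is_interval n (A : {set 'I_n}) : bool :=
  [exists alpha : posroot n, A == supp alpha].

Definition adjacent n (alpha beta : posroot n) : bool :=
  [disjoint supp alpha & supp beta] && is_interval (supp alpha :|: supp beta).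

Definition overlapping n (alpha beta : posroot n) : bool :=
  [&& ~~ (supp alpha \subset supp beta), ~~ (supp beta \subset supp alpha)
    & supp alpha :&: supp beta != set0].

Definition compat n (r s : root n) : bool :=
  match r, s with
  | inl _, inl _ => true
  | inl i, inr alpha | inr alpha, inl i => i \notin supp alpha
  | inr alpha, inr beta => ~~ (adjacent alpha beta || overlapping alpha beta)
  end.

Definition root_vector n (r : root n) : 'rV[int]_n :=
  match r with
  | inl i => - delta_mx 0 i
  | inr alpha => \sum_(i in supp alpha) delta_mx 0 i
  end.

(* Combinatorial data of a simplicial fan in Z^d: primitive ray generators,   *)
(* and the sets of rays that span a cone. Smoothness and completeness are not *)
(* recorded; Sigma(Q_n) has both properties.                                  *)
Record fan_data (d : nat) := FanData {
  rays : finType;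
  ray_vector : rays -> 'rV[int]_d;
  cone : {set rays} -> bool;
  cone0 : cone set0
}.

Definition compat_cone n (C : {set root n}) : bool :=
  [forall r in C, forall s in C, compat r s].

Fact compat_cone0 n : compat_cone (set0 : {set root n}).
Proof. by apply/forall_inP => r; rewrite inE. Qed.

Definition fan_Q (n : nat) : fan_data n :=
  FanData (@root_vector n) (@compat_cone0 n).

(* Integral cohomology of the toric variety of a smooth complete fan, by the  *)
(* Jurkiewicz-Danilov theorem: the generators are the divisor classes of the  *)
(* rays, the relations are the Stanley-Reisner monomials and, for each        *)
(* character [m], the divisor of that character.                              *)
Inductive toric_relator d (Sigma : fan_data d) : polyZ (rays Sigma) -> Prop :=
| ToricSR (C : {set rays Sigma}) of ~~ cone C :
    toric_relator (\prod_(r in C) var r)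
| ToricLin (m : 'cV[int]_d) :
    toric_relator (\sum_r (ray_vector r *m m) 0 0 *: var r).

Lemma meval0_var (I : finType) (i : I) : (var i).@[fun=> 0] = 0.
Proof. by rewrite mevalXU. Qed.

Fact toric_relator_const d (Sigma : fan_data d) p :
  toric_relator (Sigma := Sigma) p -> p.@[fun=> 0] = 0.
Proof.
case=> [C hC|m].
  have [r rC] : exists r, r \in C.
    apply/set0Pn; apply: contraNneq hC => ->; exact: cone0.
  by rewrite rmorph_prod /= (bigD1 r rC) /= meval0_var mul0r.
by rewrite raddf_sum big1 //= => r _; rewrite mevalZ meval0_var mulr0.
Qed.

Definition toric_cohomology d (Sigma : fan_data d) : comNzRingType :=
  presented (Presentation (@toric_relator_const d Sigma)).

Definition divisor_class d (Sigma : fan_data d) (r : rays Sigma) :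
  toric_cohomology Sigma := gen _ r.

Definition HQ (n : nat) : comNzRingType := toric_cohomology (fan_Q n).

Definition Tneg n (i : 'I_n) : HQ n :=
  divisor_class (Sigma := fan_Q n) (inl i).
Definition Tpos n (alpha : posroot n) : HQ n :=
  divisor_class (Sigma := fan_Q n) (inr alpha).

(* For Sigma(Q_n), the presentation above amounts to the following relations. *)
Inductive HQ_relator n : polyZ (root n) -> Prop :=
| HQ_lin (i : 'I_n) :
    HQ_relator (var (inl i)
                - \sum_(alpha : posroot n | i \in supp alpha) var (inr alpha))
| HQ_negpos (i : 'I_n) (alpha : posroot n) of i \in supp alpha :
    HQ_relator (var (inl i) * var (inr alpha))
| HQ_pos (alpha beta : posroot n)
    of adjacent alpha beta || overlapping alpha beta :
    HQ_relator (var (inr alpha) * var (inr beta)).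

Lemma root_vector_mul n (r : root n) (m : 'cV[int]_n) :
  (root_vector r *m m) 0 0 =
  match r with inl i => - m i 0 | inr alpha => \sum_(i in supp alpha) m i 0 end.
Proof.
case: r => [i|alpha] /=; first by rewrite mulNmx mxE -rowE mxE.
rewrite mulmx_suml summxE; apply: eq_bigr => i _; by rewrite -rowE mxE.
Qed.

Lemma toric_lin_fan_Q n (m : 'cV[int]_n) :
  \sum_(r : root n) (root_vector r *m m) 0 0 *: var r =
  - \sum_i m i 0 *: (var (inl i) - \sum_(alpha : posroot n | i \in supp alpha)
                                     var (inr alpha) : polyZ (root n)).
Proof.
under eq_bigr do rewrite root_vector_mul.
rewrite big_sumType /= -sumrN.
under [in RHS]eq_bigr => i _ do rewrite scalerBr opprB addrC -scaleNr.
rewrite big_split /=; congr (_ + _).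
under eq_bigr do rewrite scaler_suml.
under [RHS]eq_bigr do rewrite scaler_sumr.
by rewrite (exchange_big_dep xpredT) //=.
Qed.

Lemma HQ_presentation n (p : polyZ (root n)) :
  generated (@toric_relator n (fan_Q n)) p <-> generated (@HQ_relator n) p.
Proof.
split; apply: generated_sub => {p} p.
- case=> [C|m].
    rewrite negb_forall_in => /exists_inP[r rC].
    rewrite negb_forall_in => /exists_inP[s sC nrs].
    have rs : s != r.
      apply: contraNneq nrs => ->; case: (r) => [//|alpha] /=.
      rewrite /adjacent /overlapping subxx /= orbF negb_and; apply/orP; left.
      rewrite -setI_eq0 setIid; apply/set0Pn; exists (lo alpha).
      by rewrite inE leqnn /=; exact: (valP alpha).
    rewrite (bigD1 r rC) (bigD1 s) /=; last by apply/andP.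
    rewrite mulrA mulrC; apply: generatedM.
    case: r s nrs {rC sC rs} => [i|alpha] [j|beta] //=.
    + by move/negPn => h; apply/generated_relator/HQ_negpos.
    + by move/negPn => h; rewrite mulrC; apply/generated_relator/HQ_negpos.
    + by move/negPn => h; apply/generated_relator/HQ_pos.
  rewrite toric_lin_fan_Q -mulN1r; apply: generatedM.
  apply: (big_ind (generated (@HQ_relator n))) => [||i _].
  + exact: generated0.
  + exact: generatedD.
  rewrite -mul_mpolyC; apply/generatedM/generated_relator; exact: HQ_lin.
- have SR (r s : root n) : r != s -> ~~ compat r s ->
      generated (@toric_relator n (fan_Q n)) (var r * var s).
    move=> rs nrs.
    have -> : var r * var s =
        \prod_(t in [set r; s] : {set rays (fan_Q n)}) var t :> polyZ (root n).
      by rewrite big_setU1 ?inE //= big_set1.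
    apply/generated_relator/ToricSR; apply: contra nrs => /forall_inP h.
    by have /forall_inP := h r (set21 _ _); apply; exact: set22.
  case=> [i|i alpha ia|alpha beta ab].
  + have -> : var (inl i) - \sum_(alpha : posroot n | i \in supp alpha)
                              var (inr alpha)
            = - (\sum_(r : root n)
                  (root_vector r *m (delta_mx i 0 : 'cV[int]_n)) 0 0 *: var r)
            :> polyZ (root n).
      rewrite toric_lin_fan_Q opprK (bigD1 i) //= mxE !eqxx scale1r.
      rewrite [X in _ = _ + X]big1 ?addr0 //.
      by move=> j ji; rewrite mxE (negPf ji) scale0r.
    rewrite -mulN1r; apply: generatedM.
    by apply: generated_relator; exact: (@ToricLin n (fan_Q n)).
  + by apply: SR => //=; rewrite negbK.
  + apply: SR => /=; last by rewrite negbK.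
    apply: contraTneq ab => -[->].
    rewrite /adjacent /overlapping subxx /= orbF negb_and; apply/orP; left.
    rewrite -setI_eq0 setIid; apply/set0Pn; exists (lo beta).
    by rewrite inE leqnn /=; exact: (valP beta).
Qed.

(* [inl i] indexes S_i, [inr alpha] indexes S_alpha.                          *)
Definition Mvar (n : nat) := ('I_n + nonsimple n)%type.
HB.instance Definition _ n := Finite.on (Mvar n).

Definition vS n (i : 'I_n) : polyZ (Mvar n) := var (inl i : Mvar n).
Definition vSr n (alpha : nonsimple n) : polyZ (Mvar n) :=
  var (inr alpha : Mvar n).

(* S_{a,b} for a < b, with the dummy value 0 when b <= a.                     *)
Definition vSab n (a b : 'I_n) : polyZ (Mvar n) :=
  if [pick alpha : nonsimple n | val (val alpha) == (a, b)] is Some alpha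
  then vSr alpha else 0.

Inductive M_relator n : polyZ (Mvar n) -> Prop :=
| M_square (i : 'I_n) : M_relator (vS i ^+ 2)
| M_simple (i : 'I_n) (alpha : nonsimple n) of i \in supp (val alpha) :
    M_relator (vS i * vSr alpha
               - \sum_(j in supp (val alpha) | j != i) vS i * vS j)
| M_nonsimple (alpha beta : nonsimple n) :
    let a := lo (val alpha) in let b := hi (val alpha) in
    let c := lo (val beta) in let d := hi (val beta) in
    let A := supp (val alpha) in let B := supp (val beta) in
    let I := (A :\ a) :&: (B :\ d) in
    [&& a <= c, c <= b & b <= d]%N -> (2 <= #|A :&: B|)%N ->
    M_relator
      (vSr alpha * vSr beta
       - (\sum_(i in A :&: B) \sum_(j in A :&: B | (i < j)%N) vS i * vS j
          + \sum_(l in I) vSab a l * vSab l d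
          - \sum_(l in I) \sum_(m in I | val m == l.+1)
              vSab a l * vSab m d)).

Lemma vSabE n (alpha : nonsimple n) :
  vSab (lo (val alpha)) (hi (val alpha)) = vSr alpha.
Proof.
rewrite /vSab; case: pickP => [beta|/(_ alpha)].
  rewrite /lo /hi -surjective_pairing => /eqP h.
  by congr vSr; apply/val_inj/val_inj.
by rewrite /lo /hi -surjective_pairing eqxx.
Qed.

Lemma meval0_vSab n (a b : 'I_n) : (vSab a b).@[fun=> 0] = 0.
Proof. by rewrite /vSab; case: pickP => *; rewrite ?meval0_var ?meval0. Qed.

Fact M_relator_const n (p : polyZ (Mvar n)) :
  M_relator p -> p.@[fun=> 0] = 0.
Proof.
have E (F G : polyZ (Mvar n)) : F.@[fun=> 0] = 0 -> (F * G).@[fun=> 0] = 0.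
  by move=> F0; rewrite mevalM F0 mul0r.
have D (J : finType) (Q : pred J) (F : J -> polyZ (Mvar n)) :
    (forall j, Q j -> (F j).@[fun=> 0] = 0) ->
    (\sum_(j | Q j) F j).@[fun=> 0] = 0.
  by move=> F0; rewrite raddf_sum; apply: big1.
case=> [i|i alpha _|alpha beta a b c d A B I _ _].
- by apply/E/meval0_var.
- rewrite mevalB E ?meval0_var // D ?subr0 // => j _.
  exact/E/meval0_var.
- rewrite mevalB E ?meval0_var // mevalB mevalD !D ?(addr0, subr0) // => i _.
  + by apply: D => j _; apply/E/meval0_vSab.
  + by apply/E/meval0_vSab.
  + by apply: D => j _; apply/E/meval0_var.
Qed.

Definition Mstar (n : nat) : comNzRingType :=
  presented (Presentation (@M_relator_const n)).

Definition Ssimple n (i : 'I_n) : Mstar n := gen _ (inl i : Mvar n).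
Definition Snonsimple n (alpha : nonsimple n) : Mstar n := gen _ (inr alpha : Mvar n).

(* Main.v *)
(* For a <= b let U a b be the sum of the T_beta over the intervals beta      *)
(* containing [a, b]; thus T_{-i} = U i i, and psi sends S_{a,b} to the       *)
(* defect U a a + ... + U b b - U a b, which is 0 for a = b. Conversely,      *)
(* T_[a,b] is a second difference (corner) of U. Since this change of         *)
(* generators is invertible, it suffices to see that both sets of relations   *)
(* express the same conditions on U:                                          *)
(*   (i)  U i i * U a b = 0 for a <= i <= b;                                  *)
(*   (ii) (U a b - U a b.+1) * (U c.+1 d - U c d) = 0 for a <= c <= b < d.    *)
(* The first factor in (ii) sums the T_beta over the beta ending at b and     *)
(* starting at most at a, the second over the beta starting at c.+1 and       *)
(* ending at least at d: all these pairs are incompatible, and all            *)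
(* incompatible pairs arise so. On the other side, for fixed a and d the      *)
(* relations (3) are a summed form of their second differences in b and c,    *)
(*   (S_{a,b+1} - S_{a,b}) * (S_{c,d} - S_{c+1,d}) = S_c * S_{b+1},           *)
(* and given (i) the difference of the two sides is the left side of (ii).    *)

Require Import Defs.
From HB Require Import structures.
From mathcomp Require Import all_boot all_order all_algebra.
From mathcomp Require Import ring_quotient generic_quotient.
From mathcomp Require Import mpoly.
From mathcomp Require Import zify ring.

Set Implicit Arguments.
Unset Strict Implicit.
Unset Printing Implicit Defensive.

Import GRing.Theory.
Local Open Scope ring_scope.

(** Both presentations become conditions on a family [U] with values in an arbitrary commutative
    ring. By [HQ_relators_family] and [family_HQ_relators], killing the relations of the cohomology
    ring amounts to having a [toric_family]. By [M_relatorsP], so does killing (1)-(3), when [S_i]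
    goes to [U i i] and [S_alpha] to its [defect]: (1) and (2) amount to (i), and [mixed_sumP] with
    [defect_prod_diff] turns (3) into (ii). So each ring carries a canonical family, [V] in [HQ n]
    and [U] in [Mstar n], and by [presented_lift] the family in one ring defines a homomorphism from
    the other. The two homomorphisms exchange [U] and [V], which determine all generators, so they
    are mutually inverse. *)

(** * Homomorphisms out of a ring given by generators and relations *)

Lemma rmorph_var_ext (I : finType) (A : comNzRingType)
    (f g : {rmorphism polyZ I -> A}) :
  (forall i, f (var i) = g (var i)) -> f =1 g.
Proof.
move=> fg p; rewrite (mpolyE p) !rmorph_sum; apply: eq_bigr => m _.
rewrite -mul_mpolyC !rmorphM mpolyXE_id !rmorph_prod /=.
congr (_ * _).
  by rewrite -[mcoeff m p]intz rmorph_int rmorph_int rmorph_int.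
by apply: eq_bigr => k _; rewrite !rmorphXn -[k]enum_valK fg.
Qed.

Definition quotient_map (I : finType) (P : presentation I) :
  {rmorphism polyZ I -> presented P} := \pi_(presented P)%qT.

Lemma gen_ext (I : finType) (P : presentation I) (A : comNzRingType)
    (f g : {rmorphism presented P -> A}) :
  (forall i, f (gen P i) = g (gen P i)) -> f =1 g.
Proof.
move=> fg x; rewrite -[x]reprK.
exact: (rmorph_var_ext (f := f \o quotient_map P) (g := g \o quotient_map P) fg).
Qed.

Lemma quotient_map_eq0 (I : finType) (P : presentation I) p :
  generated P p -> quotient_map P p = 0.
Proof.
move=> hp; rewrite -(rmorph0 (quotient_map P)); apply/eqP.
by rewrite -Quotient.idealrBE subr0; apply/pidealE.
Qed.

Definition poly_eval (I : finType) (A : comNzRingType) (v : I -> A) :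
  {rmorphism polyZ I -> A} := mmap intr (fun k => v (enum_val k)).

Lemma poly_eval_var (I : finType) (A : comNzRingType) (v : I -> A) i :
  poly_eval v (var i) = v i.
Proof. by rewrite /= mmapX mmap1U enum_rankK. Qed.

Lemma presented_lift (I : finType) (P : presentation I) (A : comNzRingType)
    (f : {rmorphism polyZ I -> A}) :
  (forall p, P p -> f p = 0) ->
  exists g : {rmorphism presented P -> A}, forall i, g (gen P i) = f (var i).
Proof.
move=> fP; pose h (x : presented P) := f (repr x).
(* Two representatives of a class differ by an element of the ideal, which [f] kills. *)
have hpi p : h (\pi_(presented P)%qT p) = f p.
  apply/eqP; rewrite -subr_eq0 /h -rmorphB; apply/eqP.
  have /pidealE[s [sP ->]] : repr (\pi_(presented P)%qT p) - p \in pideal P.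
    by rewrite Quotient.idealrBE reprK.
  by rewrite rmorph_sum big_seq big1 // => x /sP/fP fx; rewrite rmorphM fx mulr0.
have hB : zmod_morphism h.
  by move=> x y; rewrite -[x]reprK -[y]reprK -rmorphB !hpi rmorphB.
have hM : monoid_morphism h.
  split=> [|x y]; first by rewrite -(rmorph1 \pi_(presented P)%qT) hpi rmorph1.
  by rewrite -[x]reprK -[y]reprK -rmorphM !hpi rmorphM.
pose g : {rmorphism presented P -> A} :=
  HB.pack h (GRing.isZmodMorphism.Build _ _ h hB)
            (GRing.isMonoidMorphism.Build _ _ h hM).
by exists g => i; exact: hpi.
Qed.

(** * Families indexed by pairs, and their second differences *)

Definition row_diff (A : comNzRingType) (U : nat -> nat -> A) a b :=
  U a b - U a b.+1.

(** The row before row 0 counts as zero, since no interval starts there. *)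
Definition corner (A : comNzRingType) (U : nat -> nat -> A) a b :=
  row_diff U a b - if a is a'.+1 then row_diff U a' b else 0.

(** The sum telescopes in both directions; the boundary terms vanish by the convention for row 0 and
    by the hypothesis on [y >= n]. *)
Lemma sum_corner (A : comNzRingType) n (U : nat -> nat -> A) a b :
  (forall x y, (n <= y)%N -> U x y = 0) ->
  \sum_(0 <= x < a.+1) \sum_(b <= y < n) corner U x y = U a b.
Proof.
move=> U0; rewrite exchange_big /=.
under eq_bigr => y _.
  have -> : \sum_(0 <= x < a.+1) corner U x y = row_diff U a y.
    elim: a => [|a IHa]; first by rewrite big_nat1 /corner subr0.
    by rewrite big_nat_recr //= IHa /corner addrC subrK.
  over.
have [bn|nb] := leqP b n; last by rewrite big_geq ?U0 // ltnW.
under eq_bigr do rewrite /row_diff -opprB.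
by rewrite sumrN telescope_sumr // U0 // sub0r opprK.
Qed.

(** Conditions (i) and (ii), with indices ranging over all naturals; the first clause handles those
    beyond the last vertex. Conditions (i) and (ii) involve [U a b] only for [a <= b]. *)
Definition toric_family (A : comNzRingType) n (U : nat -> nat -> A) :=
  [/\ forall a b, (n <= b)%N -> U a b = 0,
      forall a i b, (a <= i <= b)%N -> U i i * U a b = 0
    & forall a b c d, (a <= c <= b)%N -> (b < d)%N ->
        row_diff U a b * (U c.+1 d - U c d) = 0].

(** The first corner is a difference of two left factors of (ii), at [a] and [a-1], and the second a
    difference of two right factors, at [d] and [d+1]; all the resulting products vanish. *)
Lemma mul_corner_incompatible (A : comNzRingType) n (U : nat -> nat -> A) a b c d :
  toric_family n U -> (a < c <= b.+1)%N -> (b < d)%N ->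
  corner U a b * corner U c d = 0.
Proof.
case: c => [//|c] [_ _ U0] /andP[ac cb] bd.
have U0' x : (x <= c)%N -> row_diff U x b * corner U c.+1 d = 0.
  move=> xc; have -> : corner U c.+1 d =
      (U c.+1 d - U c d) - (U c.+1 d.+1 - U c d.+1).
    by rewrite /corner /row_diff; ring.
  by rewrite mulrBr !U0 ?subr0 //; lia.
case: a ac => [|a] ac; rewrite {1}/corner; first by rewrite subr0 U0'.
by rewrite mulrBl !U0' ?subr0 //; lia.
Qed.

Lemma mul_diag_corner (A : comNzRingType) n (U : nat -> nat -> A) a i b :
  toric_family n U -> (a <= i <= b)%N -> U i i * corner U a b = 0.
Proof.
move=> [_ U0 _] aib; rewrite /corner /row_diff.
by case: a aib => [|a] aib; rewrite !mulrBr !U0 ?mulr0 ?subr0 //; lia.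
Qed.

(* The right-hand side of relation (3), with F c b = S_{a,b} * S_{c,d}. The   *)
(* l-sums run over the whole of [c, b] rather than over the set I of (3): the *)
(* extra terms contain S_{a,a} or S_{d,d}, which are 0.                       *)
Definition mixed_sum (A : comNzRingType) (s : nat -> A) (F : nat -> nat -> A) c b :=
  \sum_(c <= j < b.+1) \sum_(c <= i < j) s i * s j
  + \sum_(c <= l < b.+1) F l l - \sum_(c <= l < b) F l.+1 l.

Lemma mixed_sum_recr (A : comNzRingType) (s : nat -> A) (F : nat -> nat -> A) c b :
  (c <= b)%N ->
  mixed_sum s F c b.+1 = mixed_sum s F c b
    + ((\sum_(c <= i < b.+1) s i * s b.+1) + F b.+1 b.+1 - F b.+1 b).
Proof.
move=> cb; rewrite /mixed_sum big_nat_recr ?leqW //=.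
rewrite [in X in _ + X - _]big_nat_recr ?leqW //=.
rewrite [in X in _ - X]big_nat_recr //=; ring.
Qed.

(** Summing the second differences over the first index telescopes to the increment of [mixed_sum]
    from [b] to [b+1]; induction on [b] then starts at [b = c], where both sides are [F c c].
    Conversely, taking second differences of [mixed_sum] leaves a single product. *)
Lemma mixed_sumP (A : comNzRingType) (s : nat -> A) (F : nat -> nat -> A) a d :
  (forall c b, (a <= c <= b)%N -> (b < d)%N ->
     F c b.+1 - F c b - F c.+1 b.+1 + F c.+1 b = s c * s b.+1) <->
  (forall c b, (a <= c <= b)%N -> (b <= d)%N -> F c b = mixed_sum s F c b).
Proof.
split=> [hF c b /andP[ac cb]|hF c b /andP[ac cb] bd].
  have step k : (c <= k < d)%N ->
      F c k.+1 - F c k = \sum_(c <= i < k.+1) s i * s k.+1 + F k.+1 k.+1 - F k.+1 k.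
    move=> ckd.
    have -> : F c k.+1 - F c k = F k.+1 k.+1 - F k.+1 k +
       \sum_(c <= i < k.+1) ((F i k.+1 - F i k) - (F i.+1 k.+1 - F i.+1 k)).
      under eq_bigr do rewrite -opprB.
      by rewrite sumrN (telescope_sumr (fun i => F i k.+1 - F i k)) ?opprB; [ring|lia].
    rewrite addrC addrA; congr (_ + _ - _); apply: eq_big_nat => i ik.
    by rewrite -hF; [ring|lia|lia].
  elim: b cb => [|b IHb] cb bd.
    have -> : c = 0%N by lia.
    by rewrite /mixed_sum big_nat1 big_geq // big_nat1 big_geq // add0r subr0.
  move: cb; rewrite leq_eqVlt => /orP[/eqP ->|cb].
    by rewrite /mixed_sum big_nat1 big_geq // big_nat1 big_geq // add0r subr0.
  by rewrite mixed_sum_recr // -IHb ?(ltnW bd) // -step; [ring|lia].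
rewrite (hF c b.+1) ?(hF c b) ?mixed_sum_recr //; try lia.
(* For [c = b] the formula does not cover [F c.+1 b], but this term and [F c.+1 b.+1] cancel against
   those produced by the recursion. *)
move: cb; rewrite leq_eqVlt => /orP[/eqP <-|cb].
  by rewrite big_nat1; ring.
rewrite (hF c.+1 b.+1) ?(hF c.+1 b) ?mixed_sum_recr //; try lia.
by rewrite [in X in X - _ + _]big_ltn ?ltnS ?(ltnW cb) //; ring.
Qed.

(** * Intervals and incompatibility in terms of endpoints *)

Lemma sum_ord_interval (V : nmodType) n (P : pred 'I_n) a b (F : nat -> V) :
  (b <= n)%N -> (forall i : 'I_n, P i = (a <= i < b)%N) ->
  \sum_(i < n | P i) F i = \sum_(a <= i < b) F i.
Proof.
move=> bn PE; rewrite (big_nat_widen _ _ n) // (big_nat_widenl _ 0) //= big_mkord.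
by apply: eq_bigl => i; rewrite PE andbC.
Qed.

Lemma mem_supp n (alpha : posroot n) (i : 'I_n) :
  (i \in supp alpha) = (lo alpha <= i <= hi alpha)%N.
Proof. by rewrite inE. Qed.

Lemma lo_le_hi n (alpha : posroot n) : (lo alpha <= hi alpha)%N.
Proof. exact: valP alpha. Qed.

Lemma posroot_eqE n (alpha beta : posroot n) :
  (alpha == beta) =
  (lo alpha == lo beta :> nat) && (hi alpha == hi beta :> nat).
Proof. by rewrite -val_eqE -pair_eqE. Qed.

Lemma sum_supp (V : nmodType) n (alpha : posroot n) (F : nat -> V) :
  \sum_(i in supp alpha) F i = \sum_(lo alpha <= i < (hi alpha).+1) F i.
Proof. by apply: sum_ord_interval => // i; rewrite mem_supp. Qed.

Lemma supp_subset n (alpha beta : posroot n) :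
  (supp alpha \subset supp beta) = (lo beta <= lo alpha)%N && (hi alpha <= hi beta)%N.
Proof.
have ha := lo_le_hi alpha; apply/idP/idP => [/subsetP sub|?].
  have := sub (lo alpha); have := sub (hi alpha); rewrite !mem_supp; lia.
by apply/subsetP => i; rewrite !mem_supp; lia.
Qed.

Lemma supp_meet n (alpha beta : posroot n) :
  (supp alpha :&: supp beta != set0) =
  (lo alpha <= hi beta)%N && (lo beta <= hi alpha)%N.
Proof.
have ha := lo_le_hi alpha; have hb := lo_le_hi beta.
apply/set0Pn/andP => [[i]|[ab ba]].
  by rewrite in_setI !mem_supp => /andP[/andP[? ?] /andP[? ?]]; split; lia.
have [le|gt] := leqP (lo alpha) (lo beta).
  by exists (lo beta); rewrite in_setI !mem_supp le ba leqnn.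
by exists (lo alpha); rewrite in_setI !mem_supp ab leqnn (ltnW gt) ha.
Qed.

Lemma overlappingE n (alpha beta : posroot n) :
  overlapping alpha beta =
  (lo alpha < lo beta <= hi alpha)%N && (hi alpha < hi beta)%N ||
  (lo beta < lo alpha <= hi beta)%N && (hi beta < hi alpha)%N.
Proof.
have ha := lo_le_hi alpha; have hb := lo_le_hi beta.
rewrite /overlapping !supp_subset supp_meet.
case: ltngtP => [lo_lt|lo_gt|lo_eq] /=.
- rewrite (leq_trans (ltnW lo_lt) hb) orbF.
  by case: ltngtP => //=; rewrite ?andbT ?andbF.
- rewrite (leq_trans (ltnW lo_gt) ha) andbT.
  by case: ltngtP => //=; rewrite ?andbT ?andbF.
- by case: ltngtP.
Qed.

Lemma adjacentC n (alpha beta : posroot n) :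
  adjacent alpha beta = adjacent beta alpha.
Proof. by rewrite /adjacent disjoint_sym setUC. Qed.

Lemma adjacentE n (alpha beta : posroot n) :
  adjacent alpha beta =
  (lo beta == (hi alpha).+1 :> nat) || (lo alpha == (hi beta).+1 :> nat).
Proof.
have to_succ (a b : posroot n) : adjacent a b -> (lo a < lo b)%N ->
    lo b = (hi a).+1 :> nat.
  have ha := lo_le_hi a; have hb := lo_le_hi b.
  case/andP=> dis /existsP[c /eqP/setP un] ab.
  have ltab : (hi a < lo b)%N.
    rewrite ltnNge; apply: contraL dis => ba; rewrite -setI_eq0 supp_meet ba.
    by rewrite (leq_trans (ltnW ab) hb).
  (* If there were a gap, the point just after [hi a] would lie in the interval [c] but in neither
     support. *)
  apply/eqP; move: ltab; rewrite leq_eqVlt eq_sym => /orP[//|gap].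
  have x_n := ltn_trans gap (ltn_ord (lo b)).
  have : lo a \in supp c by rewrite -un in_setU mem_supp leqnn ha.
  have : lo b \in supp c.
    by rewrite -un in_setU [lo b \in supp b]mem_supp leqnn hb orbT.
  rewrite !mem_supp => /andP[_ bc] /andP[ca _].
  have := un (Ordinal x_n); rewrite in_setU !mem_supp /= ltnn andbF /=.
  rewrite [X in X && _]leqNgt gap (leq_trans (ltnW gap) bc) andbT.
  by rewrite (leq_trans ca (leqW ha)).
have of_succ (a b : posroot n) : lo b = (hi a).+1 :> nat -> adjacent a b.
  have ha := lo_le_hi a; have hb := lo_le_hi b => ab.
  rewrite /adjacent -setI_eq0 -[_ == set0]negbK supp_meet ab ltnn andbF /=.
  have le : (lo a <= hi b)%N by lia.
  pose c : posroot n := exist _ (lo a, hi b) le.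
  apply/existsP; exists c; apply/eqP/setP=> x; rewrite in_setU !mem_supp.
  have -> : lo c = lo a by []; have -> : hi c = hi b by [].
  by rewrite ab; lia.
apply/idP/orP => [adj|[/eqP|/eqP]]; last 2 first.
- exact: of_succ.
- by rewrite adjacentC; exact: of_succ.
case: (ltngtP (lo alpha) (lo beta)) => [lt|lt|eq].
- by left; apply/eqP/to_succ.
- by right; apply/eqP/to_succ; rewrite // adjacentC.
- case/andP: adj; rewrite -setI_eq0 -[_ == set0]negbK supp_meet -eq lo_le_hi.
  by rewrite eq lo_le_hi.
Qed.

(** Adjacency is the boundary case [lo beta = (hi alpha).+1] of strict overlap, so one inequality
    covers both; it is the index range of (ii). *)
Lemma incompatibleE n (alpha beta : posroot n) :
  adjacent alpha beta || overlapping alpha beta =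
  (lo alpha < lo beta <= (hi alpha).+1)%N && (hi alpha < hi beta)%N ||
  (lo beta < lo alpha <= (hi beta).+1)%N && (hi beta < hi alpha)%N.
Proof.
have ha := lo_le_hi alpha; have hb := lo_le_hi beta.
rewrite adjacentE overlappingE.
case: (ltngtP (lo alpha) (lo beta)) => [lt|lt|eq] /=.
- have -> : (lo alpha == (hi beta).+1 :> nat) = false by lia.
  by rewrite !orbF; apply/idP/idP; lia.
- have -> : (lo beta == (hi alpha).+1 :> nat) = false by lia.
  by apply/idP/idP; lia.
- by apply/orP; case; lia.
Qed.

(** * The relations of the cohomology ring as conditions on [U] *)

Definition up_sum (V : nmodType) n (t : posroot n -> V) (a b : nat) : V :=
  \sum_(beta : posroot n | (lo beta <= a)%N && (b <= hi beta)%N) t beta.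

Lemma up_sum_out (V : nmodType) n (t : posroot n -> V) a b :
  (n <= b)%N -> up_sum t a b = 0.
Proof. by move=> nb; apply: big_pred0 => beta; have := ltn_ord (hi beta); lia. Qed.

(** Since [a <= b], every pair [x <= a], [y >= b] satisfies [x <= y], so the roots summed over fill
    a whole rectangle. *)
Lemma up_sum_interval (V : nmodType) n (F : nat -> nat -> V) a b : (a <= b)%N ->
  up_sum (fun beta : posroot n => F (lo beta) (hi beta)) a b =
  \sum_(0 <= x < a.+1) \sum_(b <= y < n) F x y.
Proof.
move=> ab; have [nb|bn] := leqP n b.
  by rewrite up_sum_out // big1 // => x _; rewrite big_geq.
rewrite -(@sum_ord_interval _ n (fun x : 'I_n => x <= a)%N) //; last by lia.
under [RHS]eq_bigr => x _.
  rewrite -(@sum_ord_interval _ n (fun y : 'I_n => b <= y)%N) //; last first.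
    by move=> i; rewrite ltn_ord andbT.
  over.
rewrite pair_big_dep /=.
rewrite (reindex_omap (val : posroot n -> 'I_n * 'I_n) insub) /=.
  by apply: eq_bigl => beta; rewrite valK eqxx andbT.
by move=> [x y] /= /andP[xa yb]; rewrite insubT //=; apply: leq_trans yb; lia.
Qed.

Lemma row_diff_up_sum (A : comNzRingType) n (t : posroot n -> A) a b :
  row_diff (up_sum t) a b =
  \sum_(beta : posroot n | (lo beta <= a)%N && (hi beta == b :> nat)) t beta.
Proof.
rewrite /row_diff /up_sum (bigID (fun beta : posroot n => hi beta == b :> nat)) /=.
rewrite [X in _ + X - _](eq_bigl (fun beta : posroot n =>
  (lo beta <= a)%N && (b.+1 <= hi beta)%N)) ?addrK => [|beta]; last by lia.
by apply: eq_bigl => beta; lia.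
Qed.

(** Among the intervals ending at [hi beta], only [beta] starts at [lo beta] and no earlier.
    Together with [sum_corner], this makes the change of generators invertible. *)
Lemma corner_up_sum (A : comNzRingType) n (t : posroot n -> A) beta :
  corner (up_sum t) (lo beta) (hi beta) = t beta.
Proof.
rewrite /corner row_diff_up_sum (bigD1 beta) /=; last by lia.
have E : lo beta = lo beta :> nat by [].
case: {2 3 4}(nat_of_ord (lo beta)) E => [|a] E.
  by rewrite big1 ?subr0 ?addr0 // => gamma; rewrite posroot_eqE; lia.
rewrite row_diff_up_sum -addrA -[RHS]addr0; congr (_ + _); apply/eqP.
by rewrite subr_eq0; apply/eqP/eq_bigl => gamma; rewrite posroot_eqE; lia.
Qed.

(** The linear relations identify the image of [T_{-i}] with [U i i]; the products in (i) and (ii)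
    then expand into products of incompatible generators. *)
Lemma HQ_relators_family (A : comNzRingType) n
    (g : {rmorphism polyZ (Defs.root n) -> A}) :
  (forall p, HQ_relator p -> g p = 0) ->
  let U := up_sum (fun beta : posroot n => g (var (inr beta : Defs.root n))) in
  toric_family n U /\ forall i : 'I_n, g (var (inl i : Defs.root n)) = U i i.
Proof.
move=> g0 U.
have gneg (i : 'I_n) : g (var (inl i : Defs.root n)) = U i i.
  have /eqP := g0 _ (HQ_lin i); rewrite rmorphB subr_eq0 rmorph_sum => /eqP ->.
  by apply: eq_bigl => beta; rewrite mem_supp.
split=> //; split=> [a b|a i b /andP[ai ib]|a b c d /andP[ac cb] bd].
- exact: up_sum_out.
- have [nb|bn] := leqP n b; first by rewrite [X in _ * X]up_sum_out // mulr0.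
  have i_n : (i < n)%N by lia.
  rewrite -(gneg (Ordinal i_n)) mulr_sumr big1 // => beta ab.
  by rewrite -rmorphM g0 //; apply: HQ_negpos; rewrite mem_supp /=; lia.
- have -> : U c.+1 d - U c d =
    \sum_(beta : posroot n | (lo beta == c.+1 :> nat) && (d <= hi beta)%N)
      g (var (inr beta : Defs.root n)).
    rewrite /U /up_sum (bigID (fun beta : posroot n => lo beta == c.+1 :> nat)) /=.
    rewrite [X in _ + X - _](eq_bigl (fun beta : posroot n =>
      (lo beta <= c)%N && (d <= hi beta)%N)) ?addrK => [|beta]; last by lia.
    by apply: eq_bigl => beta; lia.
  rewrite row_diff_up_sum mulr_suml big1 // => alpha ha.
  rewrite mulr_sumr big1 // => beta hb.
  by rewrite -rmorphM g0 //; apply: HQ_pos; rewrite incompatibleE; lia.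
Qed.

Lemma family_HQ_relators (A : comNzRingType) n (U : nat -> nat -> A)
    (g : {rmorphism polyZ (Defs.root n) -> A}) :
  toric_family n U ->
  (forall i : 'I_n, g (var (inl i : Defs.root n)) = U i i) ->
  (forall beta, g (var (inr beta : Defs.root n)) = corner U (lo beta) (hi beta)) ->
  forall p, HQ_relator p -> g p = 0.
Proof.
move=> UP gneg gpos _ [i|i alpha ia|alpha beta]; have [U0 _ _] := UP.
- rewrite rmorphB rmorph_sum gneg.
  have -> : \sum_(alpha : posroot n | i \in supp alpha) g (var (inr alpha : Defs.root n))
      = up_sum (fun beta : posroot n => corner U (lo beta) (hi beta)) i i.
    by apply: eq_big => [alpha|alpha _]; rewrite ?mem_supp.
  by rewrite up_sum_interval // sum_corner // subrr.
- by rewrite rmorphM gneg gpos (mul_diag_corner UP) // -mem_supp.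
- rewrite incompatibleE rmorphM !gpos => /orP[|] /andP[h1 h2].
    by rewrite (mul_corner_incompatible UP).
  by rewrite mulrC (mul_corner_incompatible UP).
Qed.

(** * The relations of [Mstar n] as conditions on [U] *)

Definition defect (A : comNzRingType) (U : nat -> nat -> A) a b :=
  \sum_(a <= k < b.+1) U k k - U a b.

Lemma defect_diag (A : comNzRingType) (U : nat -> nat -> A) a : defect U a a = 0.
Proof. by rewrite /defect big_nat1 subrr. Qed.

(** The fixed outer ends [a] and [d] come first, so that [defect_prod U a d] has the shape of [F] in
    [mixed_sum]. *)
Definition defect_prod (A : comNzRingType) (U : nat -> nat -> A) a d c b :=
  defect U a b * defect U c d.

(** The second difference factors into an increment of [defect U a] and one of [defect U] at [d]; in
    the expanded product the cross terms vanish by (i). *)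
Lemma defect_prod_diff (A : comNzRingType) (U : nat -> nat -> A) a d c b :
  (forall a i b, (a <= i <= b)%N -> U i i * U a b = 0) ->
  (a <= c <= b)%N -> (b < d)%N ->
  let F := defect_prod U a d in
  F c b.+1 - F c b - F c.+1 b.+1 + F c.+1 b =
  U c c * U b.+1 b.+1 + row_diff U a b * (U c.+1 d - U c d).
Proof.
move=> U0 acb bd /=.
have -> : defect_prod U a d c b.+1 - defect_prod U a d c b
    - defect_prod U a d c.+1 b.+1 + defect_prod U a d c.+1 b
  = (defect U a b.+1 - defect U a b) * (defect U c d - defect U c.+1 d).
  by rewrite /defect_prod; ring.
have -> : defect U a b.+1 - defect U a b = U b.+1 b.+1 + row_diff U a b.
  by rewrite /defect /row_diff big_nat_recr /=; [ring|lia].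
have -> : defect U c d - defect U c.+1 d = U c c + (U c.+1 d - U c d).
  by rewrite /defect big_ltn; [ring|lia].
have vr : U b.+1 b.+1 * (U c.+1 d - U c d) = 0 by rewrite mulrBr !U0 ?subrr //; lia.
have vl : row_diff U a b * U c c = 0.
  by rewrite mulrC mulrBr !U0 ?subrr //; lia.
by rewrite mulrDl ![_ * (U c c + _)]mulrDr vr vl addr0 add0r [U b.+1 _ * _]mulrC.
Qed.

(** The dummy value 0 of [vSab] on the diagonal agrees with [S a a = 0]. *)
Lemma rmorph_vSab (A : comNzRingType) n (f : {rmorphism polyZ (Mvar n) -> A})
    (S : nat -> nat -> A) (a b : 'I_n) :
  (forall a, S a a = 0) ->
  (forall alpha : nonsimple n,
     f (vSr alpha) = S (lo (val alpha)) (hi (val alpha))) ->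
  (a <= b)%N -> f (vSab a b) = S a b.
Proof.
move=> S0 fS ab; rewrite /vSab; case: pickP => [alpha /eqP E|none].
  by rewrite fS /lo /hi E.
move: ab; rewrite leq_eqVlt => /orP[/eqP ->|ab]; first by rewrite S0 rmorph0.
pose alpha : nonsimple n :=
  exist _ (exist _ (a, b) (ltnW ab) : posroot n) ab.
by have := none alpha; rewrite eqxx.
Qed.

Lemma rmorph_nonsimple_rhs (A : comNzRingType) n
    (f : {rmorphism polyZ (Mvar n) -> A}) (s : nat -> A) (S : nat -> nat -> A)
    (alpha beta : nonsimple n) :
  let a := lo (val alpha) in let b := hi (val alpha) in
  let c := lo (val beta) in let d := hi (val beta) in
  let X := supp (val alpha) :&: supp (val beta) in
  let I := (supp (val alpha) :\ a) :&: (supp (val beta) :\ d) in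
  (forall i : 'I_n, f (vS i) = s i) -> (forall a, S a a = 0) ->
  (forall alpha : nonsimple n,
     f (vSr alpha) = S (lo (val alpha)) (hi (val alpha))) ->
  [&& a <= c, c <= b & b <= d]%N ->
  f (\sum_(i in X) \sum_(j in X | (i < j)%N) vS i * vS j
     + \sum_(l in I) vSab a l * vSab l d
     - \sum_(l in I) \sum_(m in I | val m == l.+1) vSab a l * vSab m d) =
  mixed_sum s (fun c b => S a b * S c d) c b.
Proof.
move=> a b c d X I fs S0 fS /and3P[ac cb bd].
have memX (i : 'I_n) : (i \in X) = (c <= i <= b)%N.
  by rewrite in_setI !mem_supp -/a -/b -/c -/d; lia.
have memI (i : 'I_n) : (i \in I) =
    [&& c <= i, i <= b, i != a :> nat & i != d :> nat]%N.
  by rewrite in_setI !in_setD1 !mem_supp -/a -/b -/c -/d -!val_eqE /=; lia.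
have bn := ltn_ord b; have dn := ltn_ord d.
rewrite rmorphB rmorphD !rmorph_sum /mixed_sum; congr (_ + _ - _).
- under eq_bigr => i _.
    rewrite rmorph_sum; under eq_bigr do rewrite rmorphM !fs.
    over.
  (* Pairs [i < j] are regrouped by the larger index, as in [mixed_sum]. *)
  rewrite (exchange_big_dep (mem X)) => [|i j _ /andP[]] //=.
  rewrite -(@sum_ord_interval _ n (mem X)) //.
  apply: eq_bigr => j jX; have cjb : (c <= j <= b)%N by rewrite -memX.
  rewrite -(@sum_ord_interval _ n (fun i : 'I_n =>
    (i \in X) && (j \in X) && (i < j)%N)) //.
  - by apply: eq_bigl => i; rewrite andbA.
  - exact: ltnW.
  - by move=> i; rewrite !memX; lia.
- rewrite -(@sum_ord_interval _ n (mem X)) //.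
  rewrite [RHS](bigID (mem I)) /= [X in _ = _ + X]big1 => [|i].
    rewrite addr0; apply: eq_big => [i|i]; rewrite memI ?memX; first by lia.
    by move=> hi; rewrite rmorphM !(rmorph_vSab S0 fS) //; lia.
  rewrite memX memI => hi.
  have /orP[/eqP ->|/eqP ->] : (i == a :> nat) || (i == d :> nat) by lia.
    by rewrite S0 mul0r.
  by rewrite S0 mulr0.
- rewrite -(@sum_ord_interval _ n (fun i : 'I_n => c <= i < b)%N) //; last exact: ltnW.
  rewrite [RHS](bigID (fun i : 'I_n => (i != a :> nat) && (i.+1 != d :> nat))) /=.
  rewrite [X in _ = _ + X]big1 ?addr0 => [|i hi]; last first.
    have /orP[/eqP ->|/eqP ->] : (i == a :> nat) || (i.+1 == d :> nat) by lia.
      by rewrite S0 mul0r.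
    by rewrite S0 mulr0.
  (* For [l = b] or [l.+1 = d] the inner sum is empty, since [l.+1] is not in [I]. *)
  rewrite (bigID (fun i : 'I_n => (i < b)%N && (i.+1 != d :> nat))) /=.
  rewrite [X in _ + X]big1 ?addr0 => [|i hi]; last first.
    rewrite rmorph_sum big1 // => m; move: hi; rewrite !memI /=.
    by have := ltn_ord i; lia.
  apply: eq_big => [i|i]; rewrite memI; first by lia.
  move=> hi; have i_n : (i.+1 < n)%N by lia.
  rewrite (big_pred1 (Ordinal i_n)) => [|m]; last by rewrite memI /= -val_eqE /=; lia.
  by rewrite rmorphM !(rmorph_vSab S0 fS) //=; lia.
Qed.

Lemma card_supp_meet n (alpha beta : posroot n) :
  (lo alpha <= lo beta)%N -> (hi alpha <= hi beta)%N -> (lo beta < hi alpha)%N ->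
  (2 <= #|supp alpha :&: supp beta|)%N.
Proof.
move=> ac bd cb; have : [set lo beta; hi alpha] \subset supp alpha :&: supp beta.
  by apply/subsetP => i; rewrite in_setI !mem_supp !inE => /orP[]/eqP ->; lia.
by move/subset_leq_card; rewrite cards2 -val_eqE /= ltn_eqF.
Qed.

Lemma card_gt1_meet n (alpha beta : posroot n) :
  (2 <= #|supp alpha :&: supp beta|)%N -> (lo beta < hi alpha)%N.
Proof.
case/card_gt1P => [x [y []]]; rewrite !in_setI !mem_supp -val_eqE /=; lia.
Qed.

(** The sum in the relator cancels all of [U i i * defect] except two terms: modulo (1), relation
    (2) is exactly (i). *)
Lemma rmorph_simple_relator (A : comNzRingType) n
    (f : {rmorphism polyZ (Mvar n) -> A}) (U : nat -> nat -> A)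
    (i : 'I_n) (alpha : nonsimple n) :
  (forall i : 'I_n, f (vS i) = U i i) ->
  (forall alpha : nonsimple n,
     f (vSr alpha) = defect U (lo (val alpha)) (hi (val alpha))) ->
  i \in supp (val alpha) ->
  f (vS i * vSr alpha - \sum_(j in supp (val alpha) | j != i) vS i * vS j) =
  U i i * U i i - U i i * U (lo (val alpha)) (hi (val alpha)).
Proof.
move=> fs fS ia; rewrite rmorphB rmorphM fs fS /defect -sum_supp rmorph_sum.
rewrite (bigD1 i) //=; under [X in _ - X]eq_bigr do rewrite rmorphM !fs.
by rewrite -mulr_sumr; ring.
Qed.

Lemma M_relatorsP (A : comNzRingType) n
    (f : {rmorphism polyZ (Mvar n) -> A}) (U : nat -> nat -> A) :
  (forall a b, (n <= b)%N -> U a b = 0) ->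
  (forall i : 'I_n, f (vS i) = U i i) ->
  (forall alpha : nonsimple n,
     f (vSr alpha) = defect U (lo (val alpha)) (hi (val alpha))) ->
  (forall p, M_relator p -> f p = 0) <-> toric_family n U.
Proof.
move=> Uout fs fS; split=> [f0|[_ U0 UP] _ [i|i alpha ia|alpha beta]].
- have sqr0 (i : 'I_n) : U i i * U i i = 0.
    by rewrite -fs -rmorphM -expr2 f0 //; apply: M_square.
  have U0 a i b : (a <= i <= b)%N -> U i i * U a b = 0.
    move=> aib; have [nb|bn] := leqP n b; first by rewrite [X in _ * X]Uout ?mulr0.
    have i_n : (i < n)%N by lia.
    have [ab|ba] := ltnP a b; last first.
      have [-> ->] : a = i /\ b = i by lia.
      exact: (sqr0 (Ordinal i_n)).
    have a_n : (a < n)%N by lia.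
    pose alpha : nonsimple n := exist _
      (exist _ (Ordinal a_n, Ordinal bn) (ltnW ab) : posroot n) ab.
    have ia : Ordinal i_n \in supp (val alpha) by rewrite mem_supp.
    have := f0 _ (M_simple ia); rewrite (rmorph_simple_relator fs fS ia) sqr0.
    by move/eqP; rewrite sub0r oppr_eq0 => /eqP.
  split=> // a b c d acb bd; have [nd|dn] := leqP n d.
    by rewrite ![U _ d]Uout // subr0 mulr0.
  have /mixed_sumP/(_ c b acb bd) : forall c b, (a <= c <= b)%N -> (b <= d)%N ->
      defect_prod U a d c b = mixed_sum (fun k => U k k) (defect_prod U a d) c b.
    (* For [k = l] the supports meet in one point, so (3) gives nothing, but the identity is
       trivial. For [k < l] it is (3) for [[a,l]] and [[k,d]]. *)
    move=> k l /andP[ak]; rewrite leq_eqVlt => /orP[/eqP <- _|kl ld].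
      by rewrite /mixed_sum big_nat1 big_geq // big_nat1 big_geq // add0r subr0.
    have [a_n k_n l_n] : [/\ a < n, k < n & l < n]%N by split; lia.
    have [al kd] : (a < l)%N /\ (k < d)%N by lia.
    pose alpha : nonsimple n := exist _
      (exist _ (Ordinal a_n, Ordinal l_n) (ltnW al) : posroot n) al.
    pose beta : nonsimple n := exist _
      (exist _ (Ordinal k_n, Ordinal dn) (ltnW kd) : posroot n) kd.
    have h : [&& lo (val alpha) <= lo (val beta), lo (val beta) <= hi (val alpha)
        & hi (val alpha) <= hi (val beta)]%N by rewrite /lo /hi /=; lia.
    have /eqP := f0 _ (M_nonsimple h (@card_supp_meet n (val alpha) (val beta) ak ld kl)).
    rewrite rmorphB subr_eq0 rmorphM !fS => /eqP e.
    exact: (etrans e (rmorph_nonsimple_rhs fs (defect_diag U) fS h)).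
  rewrite defect_prod_diff // => /eqP.
  by rewrite -subr_eq0 addrC addKr => /eqP.
- by rewrite expr2 rmorphM fs U0 //; lia.
- rewrite (rmorph_simple_relator fs fS ia); move: ia; rewrite mem_supp => ia.
  by rewrite !U0 ?subrr //; lia.
- move=> a b c d X Y I h card2; have cb := card_gt1_meet card2.
  apply/eqP; rewrite rmorphB subr_eq0 rmorphM !fS; apply/eqP.
  apply: etrans (esym (rmorph_nonsimple_rhs fs (defect_diag U) fS h)).
  apply: (iffLR (mixed_sumP (fun k => U k k) (defect_prod U a d) a d)).
  + by move=> k l akl ld; rewrite defect_prod_diff // UP // addr0.
  + by case/and3P: h => -> ->.
  + by case/and3P: h.
Qed.

(** * The two mutually inverse homomorphisms *)

Theorem theorem4p2 (n : nat) (hn : (1 <= n)%N) :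
  exists psi : {rmorphism Mstar n -> HQ n},
    [/\ forall i : 'I_n, psi (Ssimple i) = Tneg i,
        forall alpha : nonsimple n,
          psi (Snonsimple alpha) =
            \sum_(i in supp (val alpha)) Tneg i
            - \sum_(beta : posroot n | supp (val alpha) \subset supp beta)
                Tpos beta
      & bijective psi].
Proof.
pose PH := Presentation (@toric_relator_const n (fan_Q n)).
pose PM := Presentation (@M_relator_const n).
pose V := up_sum (@Tpos n).
have [Vfam TnegE] : toric_family n V /\ forall i, Tneg i = V i i :> HQ n.
  apply: (@HQ_relators_family _ n (quotient_map PH)) => p /generated_relator.
  by move/(HQ_presentation p).2/(quotient_map_eq0 (P := PH)).
have Vout a b : (n <= b)%N -> V a b = 0 by case: Vfam => + _ _; apply.
pose vM (x : Mvar n) : HQ n := match x with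
  | inl i => V i i
  | inr alpha => defect V (lo (val alpha)) (hi (val alpha)) end.
have fM : forall p, M_relator p -> poly_eval vM p = 0.
  by apply/(M_relatorsP (U := V)) => // [i|alpha]; rewrite poly_eval_var.
have [psi psiE] := presented_lift (P := PM) fM.
have {}psiE x : psi (gen _ x) = vM x by rewrite psiE poly_eval_var.
pose s k : Mstar n := if insub k is Some i then Ssimple i else 0.
(* At most one root contributes, so this extends [S_{a,b}] by 0 to all pairs of naturals. *)
pose S a b : Mstar n :=
  \sum_(alpha : nonsimple n | (lo (val alpha) == a :> nat)
                              && (hi (val alpha) == b :> nat)) Snonsimple alpha.
have S_diag a : S a a = 0.
  apply: big_pred0 => alpha; have := valP alpha; rewrite /=.
  by apply: contraTF => /andP[/eqP -> /eqP ->]; rewrite ltnn.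
have sE (i : 'I_n) : s i = Ssimple i by rewrite /s valK.
have SE (alpha : nonsimple n) :
    S (lo (val alpha)) (hi (val alpha)) = Snonsimple alpha.
  by apply: big_pred1 => beta; rewrite -posroot_eqE val_eqE.
(* This solves [defect U a b = S a b] for [U a b] and cuts it off at [b >= n], as [toric_family]
   requires. *)
pose U a b : Mstar n :=
  if (b < n)%N then \sum_(a <= k < b.+1) s k - S a b else 0.
have U_diag k : (k < n)%N -> U k k = s k.
  by move=> kn; rewrite /U kn big_nat1 S_diag subr0.
have Uout a b : (n <= b)%N -> U a b = 0 by rewrite /U ltnNge => ->.
have UdefectE a b : (b < n)%N -> defect U a b = S a b.
  move=> bn; rewrite /defect {2}/U bn opprB addrC.
  rewrite [X in _ + X](eq_big_nat _ _ (F2 := s)) ?subrK // => k hk.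
  by rewrite U_diag //; lia.
have Ufam : toric_family n U.
  apply/(M_relatorsP (f := quotient_map PM)) => //.
  - by move=> i; rewrite U_diag // sE.
  - by move=> alpha; rewrite UdefectE // SE.
  - by move=> p hp; exact/(quotient_map_eq0 (P := PM))/generated_relator.
pose vH (r : Defs.root n) : Mstar n := match r with
  | inl i => U i i
  | inr beta => corner U (lo beta) (hi beta) end.
have fH p : toric_relator (Sigma := fan_Q n) p -> poly_eval vH p = 0.
  move/generated_relator/(HQ_presentation p).1 => [t [ht ->]].
  rewrite rmorph_sum big_seq big1 // => x /ht hx; rewrite rmorphM.
  rewrite (family_HQ_relators Ufam _ _ hx) ?mulr0 // => [i|beta].
    exact: poly_eval_var.
  exact: poly_eval_var.
have [phi phiE] := presented_lift (P := PH) fH.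
have {}phiE x : phi (gen _ x) = vH x by rewrite phiE poly_eval_var.
(* The restriction [a <= b] matters: for [b < a], [U a b] is 0 while [V a b] need not be. *)
have psiU a b : (a <= b)%N -> psi (U a b) = V a b.
  move=> ab; rewrite /U; case: ltnP => bn; last by rewrite rmorph0 Vout.
  have -> : V a b = \sum_(a <= k < b.+1) V k k - defect V a b.
    by rewrite /defect opprB addrC subrK.
  rewrite rmorphB rmorph_sum; congr (_ - _).
    apply: eq_big_nat => k hk; have kn : (k < n)%N by lia.
    by rewrite -[k]/(val (Ordinal kn)) sE psiE.
  move: ab; rewrite leq_eqVlt => /orP[/eqP ->|ab].
    by rewrite S_diag rmorph0 defect_diag.
  have an : (a < n)%N by lia.
  pose alpha : nonsimple n := exist _
    (exist _ (Ordinal an, Ordinal bn) (ltnW ab) : posroot n) ab.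
  by rewrite -[a]/(val (lo (val alpha))) -[b]/(val (hi (val alpha))) SE psiE.
have phiV a b : (a <= b)%N -> phi (V a b) = U a b.
  move=> ab; rewrite rmorph_sum -(sum_corner a b Uout) -up_sum_interval //.
  by apply: eq_bigr => beta _; rewrite phiE.
exists psi; split=> [i|alpha|].
- by rewrite psiE TnegE.
- rewrite psiE /= /defect -sum_supp; congr (_ - _).
    by apply: eq_bigr => i _; rewrite TnegE.
  by apply: eq_bigl => beta; rewrite supp_subset.
- exists phi => [x|y].
  + apply: (gen_ext (f := phi \o psi) (g := idfun)) => {x} -[i|alpha] /=.
      by rewrite psiE phiV // U_diag // sE.
    rewrite psiE /= rmorphB rmorph_sum phiV ?(ltnW (valP alpha)) //.
    rewrite -[RHS]/(Snonsimple alpha) -SE -UdefectE // /defect; congr (_ - _).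
    by apply: eq_big_nat => k hk; rewrite phiV.
  + apply: (gen_ext (f := psi \o phi) (g := idfun)) => {y} -[i|beta] /=.
      by rewrite phiE psiU // -TnegE.
    rewrite phiE /= -[RHS](corner_up_sum (@Tpos n)) /corner /row_diff.
    have := lo_le_hi beta; case: (nat_of_ord (lo beta)) => [|a] ab.
      by rewrite !rmorphB !psiU ?rmorph0 //; lia.
    by rewrite !rmorphB !psiU //; lia.
Qed.
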